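(* Let $s\in(0,1)$ and let $\Omega\subset\mathbb{R}^n$ be an open set. Let $\{E_h\}_{h\in\mathbb{N}}$ be a sequence of subsets of $\mathbb{R}^n$, each locally $s$-minimal in $\Omega$, with $E_h\xrightarrow{loc}E$ for some $E\subset\mathbb{R}^n$. Then $E$ is locally $s$-minimal in $\Omega$ and $$P_s(E,\Omega')=\lim_{h\to\infty}P_s(E_h,\Omega')\qquad\text{for every open }\Omega'\subset\subset\Omega.$$
   Context: All sets are Lebesgue measurable and are identified up to sets of measure zero. For disjoint $A,B\subset\mathbb{R}^n$ put $\mathcal{L}_s(A,B)=\int_A\int_B\frac{dx\,dy}{|x-y|^{n+s}}\in[0,\infty]$. The $s$-perimeter of $E\subset\mathbb{R}^n$ in an open set $\Omega\subset\mathbb{R}^n$ is, writing $E^c=\mathbb{R}^n\setminus E$, $$P_s(E,\Omega)=\mathcal{L}_s(E\cap\Omega,E^c\cap\Omega)+\mathcal{L}_s(E\cap\Omega,E^c\setminus\Omega)+\mathcal{L}_s(E\setminus\Omega,E^c\cap\Omega).$$ $E$ is $s$-minimal in $\Omega$ if $P_s(E,\Omega)<\infty$ and $P_s(E,\Omega)\leq P_s(F,\Omega)$ for every $F\subset\mathbb{R}^n$ with $F\setminus\Omega=E\setminus\Omega$. $E$ is locally $s$-minimal in $\Omega$ if it is $s$-minimal in every open set $\Omega'\subset\subset\Omega$, where $A\subset\subset B$ means that $\overline{A}$ is compact and $\overline{A}\subset B$. $E_h\xrightarrow{loc}E$ means $\chi_{E_h}\to\chi_E$ in $L^1_{loc}(\mathbb{R}^n)$.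 *)

(* Defs.v *)
From HB Require Import structures.
From mathcomp Require Import all_boot all_order all_algebra.
From mathcomp Require Import all_classical all_reals all_analysis.

Set Implicit Arguments.
Unset Strict Implicit.
Unset Printing Implicit Defensive.

Import Order.TTheory GRing.Theory Num.Theory.
Import numFieldNormedType.Exports.

Local Open Scope classical_set_scope.
Local Open Scope ring_scope.
Local Open Scope ereal_scope.

(* The space R^d, d >= 1, is ['rV[R]_n.+1] with d = n.+1; its topology is the
   product topology provided by the library. *)

Section lebesgue_outer_measure.
Context (R : realType) (n : nat).
Notation T := 'rV[R]_n.+1.

Definition box (c : T * T) : set T :=
  [set x | forall i, (c.1 ord0 i < x ord0 i <= c.2 ord0 i)%R].

(* The truncation at 0 gives volume 0 to the degenerate boxes, which are
   empty. *)
Definition box_volume (c : T * T) : \bar R :=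
  (\prod_(i < n.+1) Num.max (c.2 ord0 i - c.1 ord0 i) 0)%R%:E.

Definition lebesgue_outer (X : set T) : \bar R :=
  ereal_inf [set \sum_(k <oo) box_volume (B k) |
             B in [set B : nat -> T * T | X `<=` \bigcup_k box (B k)]].

Lemma box_volume_ge0 c : 0 <= box_volume c.
Proof. by rewrite lee_fin prodr_ge0// => i _; rewrite le_max lexx orbT. Qed.

Lemma box_volume0 : box_volume (0%R, 0%R) = 0.
Proof. by rewrite /box_volume big_ord_recl /= subrr maxxx mul0r. Qed.

Lemma lebesgue_outer_ge0 X : 0 <= lebesgue_outer X.
Proof.
apply: le_ereal_inf_tmp => _ [B _ <-].
by apply: nneseries_ge0 => k _ _; exact: box_volume_ge0.
Qed.

Lemma lebesgue_outer0 : lebesgue_outer set0 = 0.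
Proof.
apply/eqP; rewrite eq_le lebesgue_outer_ge0 andbT.
apply: ereal_inf_lbound; exists (fun=> (0%R, 0%R)) => //.
by apply: eseries0 => k _ _; exact: box_volume0.
Qed.

Lemma le_lebesgue_outer : {homo lebesgue_outer : A B / A `<=` B >-> A <= B}.
Proof.
move=> A B AB; apply/ereal_inf_le_tmp => _ [C BC <-].
by exists C => //; exact: subset_trans AB BC.
Qed.

Lemma lebesgue_outer_sigma_subadditive : sigma_subadditive lebesgue_outer.
Proof.
move=> A; have [[i ioo]|] := pselect (exists i, lebesgue_outer (A i) = +oo).
  rewrite (eseries_pinfty _ _ ioo) ?leey// => k _.
  by rewrite -ltNye (lt_le_trans _ (lebesgue_outer_ge0 _)).
rewrite -forallNE => Aoo.
apply/lee_addgt0Pr => _/posnumP[e].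
apply: le_trans (epsilon_trick _ _ _) => //; last first.
  by move=> k; exact: lebesgue_outer_ge0.
have [G PG] : {G : nat -> nat -> T * T & forall k,
    A k `<=` \bigcup_j box (G k j) /\
    \sum_(j <oo) box_volume (G k j) <=
      lebesgue_outer (A k) + (e%:num / (2 ^ k.+1)%:R)%:E}.
  apply: (@choice _ _ (fun k (g : nat -> T * T) => A k `<=` \bigcup_j box (g j) /\
    \sum_(j <oo) box_volume (g j) <=
      lebesgue_outer (A k) + (e%:num / (2 ^ k.+1)%:R)%:E)) => k.
  have fk : lebesgue_outer (A k) \is a fin_num.
    by rewrite ge0_fin_numE ?lebesgue_outer_ge0// ltey; apply/eqP/Aoo.
  have ek : (0 < e%:num / (2 ^ k.+1)%:R)%R by [].
  have [_ [B AB <-] /ltW xS] := lb_ereal_inf_adherent ek fk.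
  by exists B.
have G0 x : 0 <= (box_volume \o uncurry G) x by exact: box_volume_ge0.
apply: (@le_trans _ _ (\esum_(i in setT) (box_volume \o uncurry G) i)).
  apply: ereal_inf_lbound => /=.
  have /card_esym/ppcard_eqP[f] := card_nat2.
  exists (uncurry G \o f).
    move=> t [i _ /(PG i).1 [j _ Gij]].
    by exists (f^-1%FUN (i, j)) => //=; rewrite invK ?inE.
  rewrite -(esum_pred_image (box_volume \o uncurry G) _ xpredT)
    ?[fun=> _]set_true//.
  by rewrite image_eq.
rewrite (_ : esum _ _ = \sum_(i <oo) \sum_(j <oo) box_volume (G i j)).
  apply: lee_nneseries => [i _ _|i _]; last exact: (PG i).2.
  by apply: nneseries_ge0 => j _ _; exact: box_volume_ge0.
pose J : nat -> set (nat * nat) := fun i => [set (i, j) | j in setT].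
rewrite (_ : setT = \bigcup_k J k); last first.
  by rewrite predeqE => -[a b]; split => // _; exists a => //; exists b.
rewrite esum_bigcupT /=; last 2 first.
- apply/trivIsetP => i j _ _ ij.
  rewrite predeqE => -[k m] /=; split => //= -[] [_] _ [<-{k} _].
  by move=> [m' _] [] /esym/eqP; rewrite (negbTE ij).
- by move=> x; exact: G0.
rewrite -(image_id [set: nat]) -fun_true esum_pred_image//; last first.
  by move=> k _; apply: esum_ge0 => x _; exact: box_volume_ge0.
apply: eq_eseriesr => /= j _.
rewrite -(esum_pred_image (box_volume \o uncurry G) (pair j) predT)//=; last 2 first.
- by move=> k _; exact: box_volume_ge0.
- by move=> ? ? _ _; exact: (@can_inj _ _ _ snd).
by congr esum; rewrite predeqE => -[a b]; split; move=> [i _ <-]; exists i.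
Qed.

HB.instance Definition _ := isOuterMeasure.Build R T lebesgue_outer
  lebesgue_outer0 lebesgue_outer_ge0 le_lebesgue_outer
  lebesgue_outer_sigma_subadditive.

(* On R^d, [measurable] means Lebesgue measurable (Caratheodory's criterion),
   not only Borel. *)
HB.instance Definition _ := Measurable.copy T (caratheodory_type lebesgue_outer).

Definition lebesgue_rV : set T -> \bar R := lebesgue_outer.

HB.instance Definition _ := isMeasure.Build _ T R lebesgue_rV
  (caratheodory_measure0 lebesgue_outer)
  (caratheodory_measure_ge0 (mu := lebesgue_outer))
  (@caratheodory_measure_sigma_additive R T lebesgue_outer).

End lebesgue_outer_measure.

Section fractional_perimeter.
Context (R : realType) (n : nat).
Notation T := 'rV[R]_n.+1.
Notation mu := (@lebesgue_rV R n).
Implicit Types (s : R) (A B E F O : set T).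

(* The norm that the library puts on row vectors is the sup norm. *)
Definition euclidean_norm (x : T) : R :=
  Num.sqrt (\sum_(i < n.+1) x ord0 i ^+ 2)%R.

Definition eq_mod_null A B := mu (A `+` B) = 0.

Definition compactly_contained A B := compact (closure A) /\ closure A `<=` B.

Definition cvg_L1loc (f_ : nat -> T -> R) (f : T -> R) :=
  forall K, compact K ->
    \int[mu]_(x in K) `|f_ h x - f x|%:E @[h --> \oo] --> (0 : \bar R).

Definition set_cvg_loc (E_ : nat -> set T) E :=
  cvg_L1loc (fun h => \1_(E_ h)) \1_E.

Definition interaction s A B : \bar R :=
  \int[mu]_(x in A) \int[mu]_(y in B)
    ((euclidean_norm (x - y) `^ (n.+1%:R + s))^-1)%R%:E.

Definition perimeter s E O : \bar R :=
  interaction s (E `&` O) (~` E `&` O)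
  + interaction s (E `&` O) (~` E `\` O)
  + interaction s (E `\` O) (~` E `&` O).

Definition minimal s E O :=
  perimeter s E O < +oo /\
  forall F, measurable F -> eq_mod_null (F `\` O) (E `\` O) ->
    perimeter s E O <= perimeter s F O.

Definition locally_minimal s E O :=
  forall O', open O' -> compactly_contained O' O -> minimal s E O'.

End fractional_perimeter.

(* Main.v *)
Require Import Defs.
From HB Require Import structures.
From mathcomp Require Import all_boot all_order all_algebra.
From mathcomp Require Import all_classical all_reals all_analysis.
From mathcomp Require Import measurable_realfun zify ring lra.
Import Order.TTheory GRing.Theory Num.Theory.
Import numFieldNormedType.Exports.
Set Implicit Arguments.
Unset Strict Implicit.
Unset Printing Implicit Defensive.
Local Open Scope classical_set_scope.
Local Open Scope ring_scope.
Local Open Scope ereal_scope.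

(* The measure nu with density |x - y|^-(d+s) on pairs turns the perimeter of E
   in O into the nu-mass of the pairs (x, y), x in E, y outside E, with x or y
   in O.  On each of an increasing sequence of "cores" exhausting all pairs, nu
   is bounded by a multiple of Lebesgue measure, so E_h -> E makes the crossing
   pairs of E_h converge in nu there.  This gives lower semicontinuity of the
   mass on any set of pairs, and upper semicontinuity on sets of pairs of finite
   mass.  If O is a finite union of balls, then nu (O x ~O) is finite (dyadic
   decomposition in |x - y|, using that the t-layer along the boundary of a ball
   has measure O(t) and s < 1), so gluing a competitor F in O to E_h outside O
   yields limsup P(E_h, O) <= P(F, O): hence E is minimal in O and
   P(E_h, O) -> P(E, O).  An arbitrary Omega' is placed inside such an O: the
   perimeter in O is that in Omega' plus the mass of the pairs touching O but
   not Omega', and both terms are lower semicontinuous. *)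

(** * Lebesgue measure on row vectors *)

Section lebesgue_rV.
Context (R : realType) (n : nat).
Notation T := 'rV[R]_n.+1.
Notation mu := (@lebesgue_rV R n).
Implicit Types (x y : T) (X : set T).

(** The box itself, padded with degenerate boxes of volume 0, is an admissible cover of [X]. *)
Lemma lebesgue_rV_le_box (c : T * T) X : X `<=` box c -> mu X <= box_volume c.
Proof.
move=> Xc; apply: ereal_inf_lbound => /=.
exists (fun k : nat => if k == 0%N then c else (0%R, 0%R) : T * T).
  by move=> x /Xc cx; exists 0%N.
rewrite nneseries_recl//; last by move=> k _; exact: box_volume_ge0.
rewrite [X in _ + X]eseries0 ?adde0// => -[|k] //= _ _.
exact: box_volume0.
Qed.

Let upd (x : T) (i : 'I_n.+1) (a : R) : T :=
  \row_j (if j == i then a else x ord0 j).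

(** A box cut by the hyperplane [x_i = a]. The truncation at 0 in [box_volume] keeps the identity
    true when the hyperplane misses the box: one of the two pieces is then degenerate. *)
Let box_volume_upd (lo hi : T) i a :
  box_volume (lo, upd hi i (Num.min (hi ord0 i) a)) +
  box_volume (upd lo i (Num.max (lo ord0 i) a), hi) = box_volume (lo, hi).
Proof.
rewrite /box_volume -EFinD /upd; congr EFin.
rewrite (bigD1 i)//= [X in (_ + X)%R](bigD1 i)//= [RHS](bigD1 i)//= !mxE eqxx.
rewrite [RHS]mulrC; set p := (X in _ = (X * _)%R).
have pE (f : 'I_n.+1 -> R) :
    (forall j, j != i -> f j = Num.max (hi ord0 j - lo ord0 j)%R 0%R) ->
    (\prod_(j < n.+1 | j != i) f j)%R = p by move=> fE; exact: eq_bigr.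
rewrite !pE; try by move=> j /negbTE ji; rewrite !mxE ji.
rewrite [RHS]mulrC -mulrDl; congr (_ * _)%R.
rewrite /Num.max /Num.min; repeat case: ifPn; lra.
Qed.

(** Caratheodory's criterion: cutting every box of a cover of [X] along the hyperplane gives covers
    of the two parts of [X], with the same total volume. *)
Lemma measurable_halfspace_le (i : 'I_n.+1) (a : R) :
  measurable [set x : T | (x ord0 i <= a)%R].
Proof.
apply: le_caratheodory_measurable => X.
apply: le_ereal_inf_tmp => _ [B XB <-].
pose B1 k := ((B k).1, upd (B k).2 i (Num.min ((B k).2 ord0 i) a)).
pose B2 k := (upd (B k).1 i (Num.max ((B k).1 ord0 i) a), (B k).2).
have -> : \sum_(k <oo) box_volume (B k) =
    \sum_(k <oo) box_volume (B1 k) + \sum_(k <oo) box_volume (B2 k).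
  rewrite -nneseriesD; last 2 first.
  - by move=> k _ _; exact: box_volume_ge0.
  - by move=> k _ _; exact: box_volume_ge0.
  by apply: eq_eseriesr => k _; rewrite box_volume_upd -surjective_pairing.
apply: leeD; apply: ereal_inf_lbound.
- exists B1 => // x [/XB [k _ Bkx] /= xa]; exists k => // j /=.
  have := Bkx j; rewrite mxE; case: eqP => // ->.
  by rewrite le_min xa andbT.
- exists B2 => // x [/XB [k _ Bkx] /= /negP xa]; exists k => // j /=.
  have := Bkx j; rewrite mxE; case: eqP => // -> /andP[x1 ->].
  by rewrite andbT gt_max x1 ltNge.
Qed.

Lemma measurable_coord (i : 'I_n.+1) :
  measurable_fun [set: T] (fun x : T => x ord0 i).
Proof.
apply: (measurability _ (RGenOInfty.measurableE R)) => _ [_ [a ->] <-].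
rewrite setTI.
have -> : (fun x : T => x ord0 i) @^-1` `]a, +oo[%classic =
    ~` [set x : T | (x ord0 i <= a)%R].
  apply/seteqP; split => x /=; rewrite in_itv/= andbT ltNge; first by move/negP.
  by move/negP.
exact/measurableC/measurable_halfspace_le.
Qed.

Lemma measurable_box (c : T * T) : measurable (box c).
Proof.
have -> : box c = \bigcap_(i in [set: 'I_n.+1])
    ((fun x : T => x ord0 i) @^-1` `]c.1 ord0 i, c.2 ord0 i]%classic).
  apply/seteqP; split => x /= bx i; first by move=> _; rewrite /= in_itv/= bx.
  by have := bx i I; rewrite /= in_itv.
apply: fin_bigcap_measurable => // i _.
by rewrite -[X in measurable X]setTI; exact: measurable_coord.
Qed.

End lebesgue_rV.

(** * Measurability of open sets and sigma-finiteness *)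

Section lebesgue_rV_topology.
Context (R : realType) (n : nat).
Notation T := 'rV[R]_n.+1.
Notation mu := (@lebesgue_rV R n).
Implicit Types (x y : T) (X : set T).

Lemma lebesgue_rV_box_lty (c : T * T) : mu (box c) < +oo.
Proof.
by apply: le_lt_trans (lebesgue_rV_le_box (@subset_refl _ _)) _; exact: ltry.
Qed.

Let grid_box (u : 'rV[int]_n.+1 * nat) : set T :=
  box ((\row_j ((u.1 ord0 j)%:~R / u.2.+1%:R))%R,
       (\row_j ((u.1 ord0 j + 1)%:~R / u.2.+1%:R))%R).

(** [X] is the union of the grid boxes of mesh [1/(k+1)], over all [k], that it contains; these are
    indexed by a countable type. *)
Lemma open_measurable_rV X : open X -> measurable X.
Proof.
move=> oX.
pose F u := if `[< grid_box u `<=` X >] then grid_box u else set0.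
have -> : X = \bigcup_u F u.
  apply/seteqP; split=> [x Xx|x [u _]]; last first.
    by rewrite /F; case: ifPn => // /asboolP; exact.
  have /nbhs_ballP[e /= e0 xeX] : nbhs x X by exact: open_nbhs_nbhs.
  have [k _ /(_ k (leqnn k)) /= ke] := near_infty_natSinv_lt (PosNum e0).
  (* Boxes are open on the left and closed on the right, so the lower corner of the cell containing
     [x] is the ceiling minus 1. *)
  pose p : 'rV[int]_n.+1 := (\row_j (Num.ceil (x ord0 j * k.+1%:R) - 1))%R.
  have k0 : (0 < k.+1%:R :> R)%R by [].
  exists (p, k) => //; rewrite /F ifT.
    move=> i; rewrite /= !mxE ltr_pdivrMr// ler_pdivlMr// subrK.
    exact: Num.Theory.ceil_itv.
  apply/asboolP => y yp; apply: xeX; split=> // i j; rewrite (ord1 i).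
  have := yp j; rewrite /= !mxE ltr_pdivrMr// ler_pdivlMr// subrK.
  have := Num.Theory.ceil_itv (x ord0 j * k.+1%:R).
  move: (Num.ceil _) => z; rewrite intrB => /andP[x1 x2] /andP[y1 y2].
  have : (`|x ord0 j * k.+1%:R - y ord0 j * k.+1%:R| < 1)%R.
    rewrite ltr_norml; lra.
  rewrite -mulrBl normrM (gtr0_norm k0) -ltr_pdivlMr// mul1r => /lt_trans.
  exact.
apply: countable_bigcupT_measurable; first exact: countableP.
by move=> u; rewrite /F; case: ifPn => // _; exact: measurable_box.
Qed.

Let sigma_finite_lebesgue_rV : sigma_finite [set: T] mu.
Proof.
pose c k : T * T := (const_mx (- k%:R)%R, const_mx k%:R).
exists (fun k => box (c k)); last first.
  by move=> k; split; [exact: measurable_box|exact: lebesgue_rV_box_lty].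
apply/esym; rewrite -subTset => x _.
pose k := (\sum_i Num.bound (x ord0 i))%N; exists k => // i; rewrite !mxE/=.
have : (`|x ord0 i| < k%:R)%R.
  rewrite (lt_le_trans (unstable.ltr_norm_bound _))// ler_nat.
  by rewrite /k (bigD1 i)//= leq_addr.
by rewrite ltr_norml => /andP[-> /ltW].
Qed.

HB.instance Definition _ := Measure_isSigmaFinite.Build _ _ _ mu
  sigma_finite_lebesgue_rV.

End lebesgue_rV_topology.

(** * The fractional kernel as a measure on pairs *)

Section kernel.
Context (R : realType) (n : nat).
Notation T := 'rV[R]_n.+1.
Notation mu := (@lebesgue_rV R n).
Implicit Types (x y : T).

Lemma le_euclidean_norm x i : (`|x ord0 i| <= euclidean_norm x)%R.
Proof.
rewrite -sqrtr_sqr ler_wsqrtr// (bigD1 i)//= lerDl.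
by apply: sumr_ge0 => j _; exact: sqr_ge0.
Qed.

Lemma euclidean_norm_ge0 x : (0 <= euclidean_norm x)%R.
Proof. exact: sqrtr_ge0. Qed.

Lemma euclidean_normB x y : euclidean_norm (x - y) = euclidean_norm (y - x).
Proof.
by congr Num.sqrt; apply: eq_bigr => i _; rewrite -opprB mxE sqrrN.
Qed.

Lemma measurable_euclidean_dist :
  measurable_fun [set: T * T] (fun z => euclidean_norm (z.1 - z.2)%R).
Proof.
rewrite (_ : (fun _ => _) = (@powR R ^~ 2^-1%R) \o
    (fun z : T * T => \sum_(i < n.+1) (z.1 ord0 i - z.2 ord0 i) ^+ 2)%R); last first.
  apply/funext => z /=; rewrite powR12_sqrt; last first.
    by apply: sumr_ge0 => j _; exact: sqr_ge0.
  by congr Num.sqrt; apply: eq_bigr => i _; rewrite !mxE.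
apply: measurableT_comp; first exact: measurable_powR.
apply: measurable_sum => i; apply: measurable_funX.
apply: measurable_funB.
  exact: (measurableT_comp (measurable_coord i) measurable_fst).
exact: (measurableT_comp (measurable_coord i) measurable_snd).
Qed.

(* On the diagonal the kernel is 0, since 0 `^ p = 0 and 0^-1 = 0. *)
Definition kernel (s : R) (z : T * T) : R :=
  ((euclidean_norm (z.1 - z.2)%R `^ (n.+1%:R + s))^-1)%R.

Lemma kernel_ge0 s z : (0 <= kernel s z)%R.
Proof. by rewrite invr_ge0 powR_ge0. Qed.

Lemma kernelC s x y : kernel s (x, y) = kernel s (y, x).
Proof. by rewrite /kernel/= euclidean_normB. Qed.

Lemma measurable_kernel s : measurable_fun [set: T * T] (kernel s).
Proof.
rewrite (_ : kernel s = (@powR R ^~ (- (n.+1%:R + s)))%R \o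
    (fun z : T * T => euclidean_norm (z.1 - z.2)%R)); last first.
  by apply/funext => z; rewrite /kernel /= powRN.
by apply: measurableT_comp measurable_euclidean_dist; exact: measurable_powR.
Qed.

Lemma kernel_le s (r : R) z : (0 <= s)%R -> (0 < r)%R ->
  (r <= euclidean_norm (z.1 - z.2)%R)%R ->
  (kernel s z <= r `^ (- (n.+1%:R + s)))%R.
Proof.
move=> s0 r0 rz; rewrite powRN lef_pV2 ?posrE ?powR_gt0 ?(lt_le_trans r0)//.
by rewrite ge0_ler_powR ?nnegrE ?addr_ge0 ?(ltW r0)// euclidean_norm_ge0.
Qed.

Definition nu (s : R) (S : set (T * T)) : \bar R :=
  \int[(mu \x mu)%E]_(z in S) (kernel s z)%:E.

Let nu0 s : nu s set0 = 0.
Proof. exact: integral_set0. Qed.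

Let nu_ge0 s S : 0 <= nu s S.
Proof. by apply: integral_ge0 => z _; rewrite lee_fin kernel_ge0. Qed.

Let nu_sigma_additive s : semi_sigma_additive (nu s).
Proof.
apply: semi_sigma_additive_nng_induced.
  by apply/measurable_EFinP; exact: measurable_kernel.
by move=> z; rewrite lee_fin kernel_ge0.
Qed.

HB.instance Definition _ s := isMeasure.Build _ _ _ (nu s)
  (nu0 s) (nu_ge0 s) (@nu_sigma_additive s).

Lemma nu_le s (S : set (T * T)) (c : R) : measurable S ->
  (forall z, S z -> (kernel s z <= c)%R) ->
  nu s S <= c%:E * (mu \x mu)%E S.
Proof.
move=> mS Kc; rewrite -integral_cst//; apply: ge0_le_integral => //.
- by move=> z _; rewrite lee_fin kernel_ge0.
- by apply: measurable_funTS; apply/measurable_EFinP; exact: measurable_kernel.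
Qed.

(** The kernel is extended by 0 so that Tonelli's theorem can be applied on the whole product. *)
Let kernel_on s (A B : set T) : T * T -> \bar R :=
  (EFin \o kernel s) \_ (A `*` B).

Let measurable_kernel_on s (A B : set T) : measurable A -> measurable B ->
  measurable_fun [set: T * T] (kernel_on s A B).
Proof.
move=> mA mB; apply/(measurable_restrictT _ _).1; first exact: measurableX.
by apply: measurable_funTS; apply/measurable_EFinP; exact: measurable_kernel.
Qed.

Let kernel_on_ge0 s (A B : set T) z : 0 <= kernel_on s A B z.
Proof.
by rewrite /kernel_on patchE; case: ifPn => // _; rewrite lee_fin kernel_ge0.
Qed.

Let nuE s (A B : set T) : nu s (A `*` B) =
  \int[(mu \x mu)%E]_z (kernel_on s A B z).
Proof. by rewrite /nu integral_mkcond. Qed.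

Lemma interactionE s (A B : set T) : measurable A -> measurable B ->
  interaction s A B = nu s (A `*` B).
Proof.
move=> mA mB; rewrite nuE.
rewrite (fubini_tonelli1 _ (measurable_kernel_on s mA mB) (kernel_on_ge0 s A B)).
rewrite /interaction integral_mkcond; congr (integral _ _ _); apply/funext => x.
rewrite /fubini_F /kernel_on patchE; case: ifPn => xA.
  rewrite [LHS]integral_mkcond; congr (integral _ _ _); apply/funext => y.
  by rewrite !patchE in_setX/= xA.
by apply/esym/integral0_eq => y _; rewrite patchE in_setX/= (negbTE xA).
Qed.

(** By symmetry of the kernel, integrating first in [y] for [(A, B)] is integrating first in [x] for
    [(B, A)]; Tonelli identifies each with a double integral. *)
Lemma nu_swap s (A B : set T) : measurable A -> measurable B ->
  nu s (A `*` B) = nu s (B `*` A).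
Proof.
move=> mA mB; rewrite !nuE.
have E : fubini_F mu (kernel_on s A B) = fubini_G mu (kernel_on s B A).
  apply/funext => x; apply: eq_integral => y _.
  by rewrite /kernel_on !patchE !in_setX/= andbC kernelC.
transitivity (\int[mu]_x fubini_F mu (kernel_on s A B) x).
  exact: fubini_tonelli1 (measurable_kernel_on s mA mB) (kernel_on_ge0 s A B).
rewrite E; apply/esym.
exact: fubini_tonelli2 (measurable_kernel_on s mB mA) (kernel_on_ge0 s B A).
Qed.

End kernel.

(** * Local convergence in measure *)

Lemma lt_ereal_gap (R : realType) (a : R) (l : \bar R) : a%:E < l ->
  exists2 e : R, (0 < e)%R & (a + e)%:E < l.
Proof.
case: l => [l| |]//; last by exists 1%R; rewrite // ltry.
by rewrite lte_fin => al; exists ((l - a) / 2)%R; rewrite ?lte_fin; lra.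
Qed.

Section local_convergence_in_measure.
Context d (T : measurableType d) (R : realType).
Variables (nu : {measure set T -> \bar R}) (Z : nat -> set T).
Hypothesis mZ : forall j, measurable (Z j).
Hypothesis Z_nd : {homo Z : i j / (i <= j)%N >-> (i <= j)%O}.
Hypothesis Z_cover : \bigcup_j Z j = [set: T].
Variables (S_ : nat -> set T) (S : set T).
Hypotheses (mS_ : forall h, measurable (S_ h)) (mS : measurable S).
Hypothesis S_cvg : forall j (e : R), (0 < e)%R ->
  \forall h \near \oo, nu (Z j `&` (S_ h `+` S)) < e%:E.
Variables (W : set T) (mW : measurable W).

Let mZS j h : measurable (Z j `&` (S_ h `+` S)).
Proof. by apply: measurableI => //; apply: measurableU; apply: measurableD. Qed.

(** By continuity from below, some [Z j] already carries mass above [r + e] of the limit set in [W];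
    for large [h], passing to [S_ h] loses less than [e] there. *)
Lemma lt_near_liminf (r : R) : r%:E < nu (S `&` W) ->
  \forall h \near \oo, r%:E < nu (S_ h `&` W).
Proof.
move=> /lt_ereal_gap[e e0 reS].
pose F j := S `&` W `&` Z j.
have mF j : measurable (F j) by apply: measurableI => //; exact: measurableI.
have FE : \bigcup_j F j = S `&` W by rewrite -setI_bigcupr Z_cover setIT.
have : nu (F j) @[j --> \oo] --> nu (S `&` W).
  rewrite -FE; apply: nondecreasing_cvg_mu => //.
    by apply: bigcupT_measurable.
  by move=> i j ij; apply/subsetPset; apply: setIS; exact/subsetPset/Z_nd.
move=> /(_ _ (open_ereal_gt' reS)) [j _ /(_ j (leqnn j)) /= reF].
near=> h.
have : nu (F j) <= nu (S_ h `&` W) + nu (Z j `&` (S_ h `+` S)).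
  apply: le_trans (measureU2 _ _ _) => //; last exact: measurableI.
  apply: le_measure; rewrite ?inE//.
    by apply: measurableU => //; exact: measurableI.
  move=> x [[Sx Wx] Zx]; have [Shx|Shx] := pselect (S_ h x); [left|right] => //.
  by split => //; right.
move=> /(lt_le_trans reF); rewrite EFinD => h1.
have h2 : nu (Z j `&` (S_ h `+` S)) < e%:E by near: h; exact: S_cvg.
rewrite ltNge; apply/negP => h3; move: h1; rewrite ltNge => /negP; apply.
by apply: leeD => //; exact: ltW.
Unshelve. all: by end_near. Qed.

(** Since [W] has finite mass, continuity from above makes the mass of [W] outside some [Z j] less
    than [e / 2]; inside [Z j] the symmetric difference costs at most another [e / 2]. *)
Lemma near_le_limsup (e : R) : nu W < +oo -> (0 < e)%R ->
  \forall h \near \oo, nu (S_ h `&` W) <= nu (S `&` W) + e%:E.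
Proof.
move=> Wfin e0.
have e20 : (0 < e / 2)%R by rewrite divr_gt0.
pose F j := W `\` Z j.
have mF j : measurable (F j) by exact: measurableD.
have FE : \bigcap_j F j = set0.
  rewrite -subset0 => x Fx.
  have [j _ Zx] : (\bigcup_j Z j) x by rewrite Z_cover.
  by have [] := Fx j I.
have : nu (F j) @[j --> \oo] --> (0 : \bar R).
  rewrite -(measure0 nu) -FE; apply: nonincreasing_cvg_mu => //.
  - by rewrite (le_lt_trans _ Wfin)// le_measure ?inE// => x [].
  - by apply: bigcapT_measurable.
  - by move=> i j ij; apply/subsetPset; apply: setDS; exact/subsetPset/Z_nd.
have e20' : (0 : \bar R) < (e / 2)%:E by rewrite lte_fin.
move=> /(_ _ (open_ereal_lt' e20')) [j _ /(_ j (leqnn j)) /= Fe].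
near=> h.
have h2 : nu (Z j `&` (S_ h `+` S)) < (e / 2)%:E by near: h; exact: S_cvg.
apply: (@le_trans _ _ (nu (S `&` W) + (nu (F j) + nu (Z j `&` (S_ h `+` S))))); last first.
  by rewrite leeD2l// (splitr e) EFinD; apply: leeD; exact: ltW.
apply: le_trans; last first.
  by apply: leeD; [exact: lexx|exact: measureU2].
apply: le_trans (measureU2 _ _ _) => //; last 2 first.
- exact: measurableI.
- exact: measurableU.
apply: le_measure; rewrite ?inE//; first exact: measurableI.
  by apply: measurableU; [exact: measurableI|exact: measurableU].
move=> x [Shx Wx]; have [Sx|Sx] := pselect (S x); first by left.
have [Zx|Zx] := pselect (Z j x); right; [right|left] => //.
by split=> //; left.
Unshelve. all: by end_near. Qed.

End local_convergence_in_measure.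

Lemma measurable_symdiff d (T : measurableType d) (A B : set T) :
  measurable A -> measurable B -> measurable (A `+` B).
Proof. by move=> mA mB; apply: measurableU; exact: measurableD. Qed.

(** * Perimeter as a mass of crossing pairs, and the exhausting cores *)

Section crossing_pairs.
Context (R : realType) (n : nat).
Notation T := 'rV[R]_n.+1.
Notation mu := (@lebesgue_rV R n).
Implicit Types (A B E F O : set T) (s : R).

Definition crossing E : set (T * T) := E `*` ~` E.

Definition touching O : set (T * T) := (O `*` setT) `|` (setT `*` O).

Lemma measurable_crossing E : measurable E -> measurable (crossing E).
Proof. by move=> mE; apply: measurableX => //; exact: measurableC. Qed.

Lemma measurable_touching O : measurable O -> measurable (touching O).
Proof. by move=> mO; apply: measurableU; exact: measurableX. Qed.

(** The three interactions are the disjoint pieces of the right-hand set where both points, only the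
    first, or only the second lie in [O]. *)
Lemma perimeterE s E O : measurable E -> measurable O ->
  perimeter s E O = nu s (crossing E `&` touching O).
Proof.
move=> mE mO; have mEc := measurableC mE.
have mEO := measurableI _ _ mE mO; have mED := measurableD mE mO.
have mEcO := measurableI _ _ mEc mO; have mEcD := measurableD mEc mO.
rewrite /perimeter !interactionE//.
rewrite -measureU; [|exact: measurableX|exact: measurableX|]; last first.
  by rewrite -subset0 => -[x y] [] [/= _ [_ yO]] [/= _ [_ /(_ yO)]].
rewrite -measureU; [|by apply: measurableU; exact: measurableX|exact: measurableX|]; last first.
  by rewrite -subset0 => -[x y] [] [] [/= [_ xO] _] [/= [_ /(_ xO)]].
congr (nu s _); apply/seteqP; split => -[x y].
  by rewrite /crossing /touching /=; tauto.
rewrite /crossing /touching /=.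
by have := pselect (O x); have := pselect (O y); tauto.
Qed.

Lemma crossing_symdiff_subset A B : crossing A `+` crossing B `<=`
  ((A `+` B) `*` setT) `|` (setT `*` (A `+` B)).
Proof.
move=> [x y]; rewrite /crossing /=.
by have := pselect (A x); have := pselect (A y);
   have := pselect (B x); have := pselect (B y); tauto.
Qed.

Lemma nu_null s (S : set (T * T)) : measurable S -> (mu \x mu)%E S = 0 ->
  nu s S = 0.
Proof.
move=> mS S0; apply: null_set_integral => //.
by apply: measurable_funTS; apply/measurable_EFinP; exact: measurable_kernel.
Qed.

Lemma compact_closed_ball_rV (x : T) (r : R) :
  compact [set y : T | forall i, (`|x ord0 i - y ord0 i| <= r)%R].
Proof.
pose I i := `[(x ord0 i - r)%R, (x ord0 i + r)%R]%classic.
have -> : [set y : T | forall i, (`|x ord0 i - y ord0 i| <= r)%R] =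
    [set y : T | forall i, I i (y ord0 i)].
  by apply/seteqP; split => y + i => /(_ i); rewrite /I/= in_itv/= ler_distlC.
by apply: (@rV_compact R n.+1 I) => i; exact: segment_compact.
Qed.

Definition cube (j : nat) : set T :=
  [set x | forall i, (`|x ord0 i| <= j%:R)%R].

Lemma compact_cube j : compact (cube j).
Proof.
have -> : cube j = [set x | forall i, (`|(0 : T) ord0 i - x ord0 i| <= j%:R)%R].
  by apply/seteqP; split => x + i => /(_ i); rewrite !mxE sub0r normrN.
exact: compact_closed_ball_rV.
Qed.

Lemma measurable_cube j : measurable (cube j).
Proof.
rewrite -[cube j]setCK; apply: measurableC; apply: open_measurable_rV.
rewrite openC; apply: compact_closed; last exact: compact_cube.
exact: norm_hausdorff.
Qed.

Lemma cube_lty j : mu (cube j) < +oo.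
Proof.
(* The lower corner is [-(j+1)] because boxes omit their left faces, while [cube j] is closed. *)
have cj : cube j `<=` box (const_mx (- j.+1%:R)%R : T, const_mx j%:R : T).
  move=> x xj i; rewrite !mxE/=; have := xj i; rewrite ler_norml => /andP[+ ->].
  by rewrite andbT; apply: lt_le_trans; rewrite ltrN2 ltr_nat.
by apply: le_lt_trans (lebesgue_rV_le_box cj) _; exact: ltry.
Qed.

(** Capping the kernel itself, rather than the distance from below, lets the cores also absorb the
    diagonal, where the kernel is 0. *)
Definition core s (j : nat) : set (T * T) :=
  (cube j `*` cube j) `&` [set z | (kernel s z <= j%:R)%R].

Lemma measurable_core s j : measurable (core s j).
Proof.
apply: measurableI; first by apply: measurableX; exact: measurable_cube.
have -> : [set z | (kernel s z <= j%:R)%R] =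
    [set: T * T] `&` kernel s @^-1` `]-oo, j%:R%R]%classic.
  by rewrite setTI; apply/seteqP; split => z /=; rewrite in_itv.
exact: measurable_kernel.
Qed.

Lemma core_nondecreasing s : {homo core s : i j / (i <= j)%N >-> (i <= j)%O}.
Proof.
move=> i j ij; apply/subsetPset => z [[z1 z2] /= zi].
have ijR : (i%:R <= j%:R :> R)%R by rewrite ler_nat.
by split; [split=> k; exact: le_trans ijR|exact: le_trans ijR].
Qed.

Lemma bigcup_core s : \bigcup_j core s j = [set: T * T].
Proof.
rewrite -subTset => z _.
(* One integer dominating the kernel at [z] and all coordinates of both points. *)
pose k := (Num.bound (kernel s z) + \sum_i Num.bound (z.1 ord0 i) +
  \sum_i Num.bound (z.2 ord0 i))%N.
exists k => //; split; last first.
  rewrite /= (le_trans (ltW (archi_boundP (kernel_ge0 s z))))// ler_nat.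
  by rewrite /k -addnA leq_addr.
by split=> i; rewrite (le_trans (ltW (unstable.ltr_norm_bound _)))// ler_nat /k
  (bigD1 i)//= [X in (_ <= _ + X)%N](bigD1 i)//=; lia.
Qed.

End crossing_pairs.

(** * Balls have finite fractional perimeter *)

Lemma nneseries_geometric_lty (R : realType) (a q : R) : (0 <= a)%R ->
  (0 < q < 1)%R -> \sum_(k <oo) (a * q ^+ k)%:E < +oo.
Proof.
move=> a0 /andP[q0 q1].
have aq0 k : 0 <= (a * q ^+ k)%:E by rewrite lee_fin mulr_ge0// exprn_ge0// ltW.
apply: (@le_lt_trans _ _ (a / (1 - q))%:E); last exact: ltry.
apply: lime_le; first by apply: is_cvg_nneseries => k _ _; exact: aq0.
apply: nearW => k; rewrite sumEFin lee_fin.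
by apply: geometric_le_lim => //; rewrite gtr0_norm.
Qed.

Section ball_perimeter.
Context (R : realType) (n : nat).
Notation T := 'rV[R]_n.+1.
Notation mu := (@lebesgue_rV R n).
Implicit Types (x y c : T) (A : set T) (r s t : R).

Lemma ball_rVE c r x : (0 < r)%R ->
  ball c r x <-> forall i, (`|c ord0 i - x ord0 i| < r)%R.
Proof.
move=> r0; split=> [[_ h] i|h]; first exact: (h ord0 i).
by split=> // i j; rewrite (ord1 i); exact: h.
Qed.

(** Balls of the sup norm are cubes. A point of the cube that is [t]-close to the outside lies in a
    slab of thickness [t] along one of the [2 * n.+1] faces; each slab has volume
    [(2 * r) ^+ n * t], whence [C]. *)
Lemma ball_boundary_slab c r : (0 < r)%R -> exists2 C : R, (0 <= C)%R &
  forall t, (0 < t)%R -> exists A, [/\ measurable A, mu A <= (C * t)%:E &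
    forall x y, ball c r x -> ~ ball c r y ->
      (forall i, (`|x ord0 i - y ord0 i| < t)%R) -> A x].
Proof.
move=> r0; pose P (i : 'I_n.+1) := (\prod_(j < n.+1 | j != i) (2 * r))%R.
have P0 i : (0 <= P i)%R by apply: prodr_ge0 => j _; lra.
exists (\sum_(i < n.+1) (P i * 2))%R.
  by apply: sumr_ge0 => i _; rewrite mulr_ge0.
move=> t t0.
pose lo : T := (\row_j (c ord0 j - r))%R.
pose hi : T := (\row_j (c ord0 j + r))%R.
pose up (i : 'I_n.+1) : T * T :=
  ((\row_j (if j == i then c ord0 i + r - t else lo ord0 j))%R, hi).
pose dn (i : 'I_n.+1) : T * T :=
  (lo, (\row_j (if j == i then c ord0 i - r + t else hi ord0 j))%R).
have up_vol i : box_volume (up i) = (P i * t)%:E.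
  rewrite /box_volume (bigD1 i)//= !mxE eqxx mulrC; congr (_ * _)%:E.
    apply: eq_bigr => j /negbTE ji; rewrite !mxE ji max_l; lra.
  rewrite max_l; lra.
have dn_vol i : box_volume (dn i) = (P i * t)%:E.
  rewrite /box_volume (bigD1 i)//= !mxE eqxx mulrC; congr (_ * _)%:E.
    apply: eq_bigr => j /negbTE ji; rewrite !mxE ji max_l; lra.
  rewrite max_l; lra.
pose slab k := box (up (inord k)) `|` box (dn (inord k)).
have mslab k : measurable (slab k) by apply: measurableU; exact: measurable_box.
exists (\big[setU/set0]_(i < n.+1) slab i); split.
- exact: bigsetU_measurable.
- apply: le_trans (Boole_inequality _ (fun i _ => mslab i)) _.
  rewrite big_distrl/= -sumEFin; apply: lee_sum => i _.
  apply: le_trans (measureU2 _ (measurable_box _) (measurable_box _)) _.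
  rewrite -mulrA mulr2n mulrDl mul1r mulrDr EFinD inord_val.
  by apply: leeD; apply: le_trans (lebesgue_rV_le_box (@subset_refl _ _)) _;
    rewrite ?up_vol ?dn_vol.
- move=> x y /(ball_rVE _ _ r0) xc /(ball_rVE _ _ r0) yc xy.
  have [i /negP] : exists i, ~ (`|c ord0 i - y ord0 i| < r)%R.
    by apply/existsNP.
  rewrite -leNgt => yi; rewrite -bigcup_mkord; exists i; first exact: ltn_ord.
  have := xy i; have := xc i; rewrite /slab inord_val !ltr_norml.
  move=> /andP[x1 x2] /andP[x3 x4].
  have xlohi j : (lo ord0 j < x ord0 j <= hi ord0 j)%R.
    have := xc j; rewrite !mxE ltr_norml => /andP[? ?]; lra.
  (* The sign of [c_i - y_i] tells whether [y] lies beyond the lower face ([dn]) or the upper face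
     ([up]) in direction [i]. *)
  move: yi; rewrite ler_normr => /orP[yi|yi]; [right|left] => j /=;
    have := xlohi j; rewrite !mxE; case: eqP => // -> /andP[? ?]; lra.
Qed.

(** The section of [S] over a point [x] of [A] lies in the cube of side [2 * t] about [x], and the
    other sections are empty. *)
Lemma measure_near_diagonal (S : set (T * T)) A t :
  measurable S -> measurable A ->
  (forall z, S z -> A z.1 /\ forall i, (`|z.1 ord0 i - z.2 ord0 i| < t)%R) ->
  (0 < t)%R -> (mu \x mu)%E S <= ((2 * t) ^+ n.+1)%:E * mu A.
Proof.
move=> mS mA SA t0.
have c0 : (0 <= (2 * t) ^+ n.+1)%R by rewrite exprn_ge0//; lra.
(* The right-hand side becomes the integral of a multiple of the indicator of [A], to be compared
   pointwise with the measures of the sections. *)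
rewrite -[A]setIT -integral_indic// -ge0_integralZl//; last first.
  by apply/measurable_EFinP; exact: measurable_indic.
rewrite [leLHS]/(\int[mu]_x (mu \o xsection S) x).
apply: ge0_le_integral; first exact: measurableT.
- by move=> x _; exact: measure_ge0.
- exact: measurable_fun_xsection.
- apply: measurable_funeM; apply/measurable_EFinP; exact: measurable_indic.
- move=> x _ /=; rewrite indicE; case: (boolP (x \in A)) => xA; last first.
  rewrite mule0 (_ : xsection S x = set0) ?measure0// -subset0 => y.
  by rewrite /xsection/= inE => /SA[/= /mem_set]; rewrite (negbTE xA).
pose b : T * T := ((\row_j (x ord0 j - t))%R, (\row_j (x ord0 j + t))%R).
rewrite mule1; apply: (@le_trans _ _ (box_volume b)).
  apply: lebesgue_rV_le_box => y; rewrite /xsection/= inE => /SA[_ /= xy] i.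
  rewrite !mxE; have := xy i; rewrite ltr_norml; lra.
rewrite /box_volume lee_fin (eq_bigr (fun=> 2 * t)%R) => [|i _].
  by rewrite prodr_const card_ord.
rewrite !mxE max_l; lra.
Qed.

(** The lower bound [r] on the distance bounds the kernel; the upper bound [t], which passes to each
    coordinate, bounds the Lebesgue measure of [S]. *)
Lemma nu_near_diagonal s (S : set (T * T)) A t r (V : R) :
  (0 <= s)%R -> measurable S -> measurable A -> mu A <= V%:E ->
  (0 < r)%R -> (0 < t)%R ->
  (forall z, S z -> A z.1 /\ (r <= euclidean_norm (z.1 - z.2) < t)%R) ->
  nu s S <= (r `^ (- (n.+1%:R + s)) * ((2 * t) ^+ n.+1 * V))%:E.
Proof.
move=> s0 mS mA AV r0 t0 SA.
have SK z : S z -> (kernel s z <= r `^ (- (n.+1%:R + s)))%R.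
  by move=> /SA[_ /andP[rz _]]; exact: kernel_le.
apply: le_trans (nu_le mS SK) _; rewrite EFinM lee_wpmul2l ?lee_fin ?powR_ge0//.
apply: (@le_trans _ _ (((2 * t) ^+ n.+1)%:E * mu A)).
  apply: measure_near_diagonal => // z /SA[Az /andP[_ zt]]; split => // i.
  apply: le_lt_trans zt.
  by have := le_euclidean_norm (z.1 - z.2)%R i; rewrite !mxE.
by rewrite EFinM lee_wpmul2l// lee_fin exprn_ge0//; lra.
Qed.

End ball_perimeter.

(** The exponent is the least one satisfying one inequality; minimality gives the other, except at
    [k = 0], where it is the comparison of [r] with 1. *)
Lemma geometric_bracket (R : realType) (r : R) : (0 < r)%R ->
  exists k, (2^-1 ^+ k.+1 <= r < 2^-1 ^+ k)%R \/ (2 ^+ k <= r < 2 ^+ k.+1)%R.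
Proof.
move=> r0; have [r1|r1] := ltP r 1%R.
  have exk : exists k, (2^-1 ^+ k.+1 <= r)%R.
    exists (Num.bound r^-1); rewrite exprVn invf_ple ?posrE ?exprn_gt0//.
    by apply/ltW; apply: upper_nthrootP; exact: leqnSn.
  case: (ex_minnP exk) => k rk kmin; exists k; left; rewrite rk/=.
  case: k rk kmin => [|k] rk kmin; first by rewrite expr0.
  by rewrite ltNge; apply/negP => /kmin; rewrite ltnn.
have exk : exists k, (r < 2 ^+ k.+1)%R.
  exists (Num.bound r); apply: upper_nthrootP; exact: leqnSn.
case: (ex_minnP exk) => k rk kmin; exists k; right; rewrite rk andbT.
case: k rk kmin => [|k] rk kmin; first by rewrite expr0.
by rewrite leNgt; apply/negP => /kmin; rewrite ltnn.
Qed.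

Section ball_perimeter_finite.
Context (R : realType) (n : nat).
Notation T := 'rV[R]_n.+1.
Notation mu := (@lebesgue_rV R n).
Implicit Types (x y c : T) (A : set T) (r s t : R).

Lemma measurable_ball_rV c r : measurable (ball c r).
Proof. by apply: open_measurable_rV; exact: ball_open. Qed.

Lemma powR_exprn t a (k : nat) :
  (0 <= t)%R -> ((t ^+ k) `^ a = (t `^ a) ^+ k)%R.
Proof.
move=> t0; elim: k => [|k ih]; first by rewrite !expr0 powR1.
by rewrite !exprS powRM ?ih// exprn_ge0.
Qed.

Lemma ball_lty c r : exists2 V : R, (0 <= V)%R & mu (ball c r) <= V%:E.
Proof.
pose b : T * T := ((\row_j (c ord0 j - r))%R, (\row_j (c ord0 j + r))%R).
have cb : ball c r `<=` box b.
  move=> x [r0 h] i; rewrite !mxE; have := h ord0 i.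
  rewrite /ball/= ltr_norml; lra.
exists (fine (box_volume b)); first by rewrite fine_ge0// box_volume_ge0.
by rewrite fineK//; exact: lebesgue_rV_le_box.
Qed.

(** Write [d = n.+1]. At distance about [t = 2^-k] the first point lies in a boundary layer of
    measure [O(t)], so the mass is [O(t^-(d+s) t^d t) = O(t^(1-s))]. At distance about [t = 2^k] the
    first point is only known to lie in the ball, and the mass is [O(t^-(d+s) t^d) = O(t^-s)]. Both
    series are geometric with ratio below 1, as [0 < s < 1]. *)
Lemma nu_ball_complement_lty s c r : (0 < s < 1)%R -> (0 < r)%R ->
  nu s (ball c r `*` ~` ball c r) < +oo.
Proof.
move=> /andP[s0 s1] r0; set Q := ball c r; set W := _ `*` _.
have mQ : measurable Q by exact: measurable_ball_rV.
have mW : measurable W by apply: measurableX => //; exact: measurableC.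
pose dist (z : T * T) := euclidean_norm (z.1 - z.2)%R.
have mdist (I : interval R) : measurable (dist @^-1` [set` I]).
  by rewrite -[X in measurable X]setTI; exact: measurable_euclidean_dist.
pose near k := W `&` dist @^-1` `[(2^-1 ^+ k.+1)%R, (2^-1 ^+ k)%R[%classic.
pose far k := W `&` dist @^-1` `[(2 ^+ k)%R, (2 ^+ k.+1)%R[%classic.
have mnear k : measurable (near k) by exact: measurableI.
have mfar k : measurable (far k) by exact: measurableI.
have Wcover : W `<=` \bigcup_k (near k `|` far k).
  move=> -[x y] Wxy; have [Qx Qy] := Wxy.
  (* In a coordinate where [y] leaves the ball, [x] and [y] must differ. *)
  have xy0 : (0 < dist (x, y))%R.
    move: Qx Qy => /(ball_rVE _ _ r0) xc /(ball_rVE _ _ r0) yc.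
    have [i /negP] : exists i, ~ (`|c ord0 i - y ord0 i| < r)%R by apply/existsNP.
    rewrite -leNgt => yi; apply: lt_le_trans (le_euclidean_norm _ i).
    rewrite normr_gt0 !mxE/= subr_eq0; apply: contraTneq yi => <-.
    by rewrite -ltNge.
  have [k [kd|kd]] := geometric_bracket xy0; exists k => //; [left|right];
    by split=> //=; rewrite in_itv.
have [C C0 slabP] := ball_boundary_slab c r0.
have [V V0 QV] := ball_lty c r.
(* The first factor comes from the inner radius of the layer, which is half of [t = 2^-k]. *)
pose a1 := (2^-1 `^ (- (n.+1%:R + s)) * (2 ^+ n.+1 * C))%R.
pose q1 := (2^-1 `^ (1 - s) : R)%R.
have near_le k : nu s (near k) <= (a1 * q1 ^+ k)%:E.
  set t := (2^-1 ^+ k : R)%R; have t0 : (0 < t)%R by rewrite exprn_gt0.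
  have [A [mA At AQ]] := slabP _ t0.
  have t20 : (0 < 2^-1 ^+ k.+1 :> R)%R by rewrite exprn_gt0.
  apply: le_trans (nu_near_diagonal (ltW s0) (mnear k) mA At t20 t0 _) _.
    move=> z [[Qz1 Qz2]] /=; rewrite in_itv/= => zd; split => //.
    apply: (AQ _ _ Qz1 Qz2) => i; have /andP[_] := zd; apply: le_lt_trans.
    by have := le_euclidean_norm (z.1 - z.2)%R i; rewrite !mxE.
  rewrite lee_fin /a1 /q1 exprS powRM ?(ltW t0)// -powR_exprn//.
  rewrite exprMn -/t (_ : 1 - s = - (n.+1%:R + s) + n.+2%:R)%R; last first.
    by rewrite -[in RHS]natr1; lra.
  rewrite powRD; last by apply/implyP => _; rewrite gt_eqF.
  rewrite powR_mulrn ?(ltW t0)// (exprS t n.+1).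
  by rewrite le_eqVlt; apply/orP; left; apply/eqP; ring.
(* The 4 is the side [2 * 2^(k+1)] of the cube around a point, relative to [t = 2^k]. *)
pose a2 := (4 ^+ n.+1 * V)%R; pose q2 := (2 `^ (- s) : R)%R.
have far_le k : nu s (far k) <= (a2 * q2 ^+ k)%:E.
  set t := (2 ^+ k : R)%R; have t0 : (0 < t)%R by rewrite exprn_gt0.
  have t20 : (0 < 2 ^+ k.+1 :> R)%R by rewrite exprn_gt0.
  apply: le_trans (nu_near_diagonal (ltW s0) (mfar k) mQ QV t0 t20 _) _.
    by move=> z [[Qz1 Qz2]] /=; rewrite in_itv.
  rewrite lee_fin /a2 /q2 -powR_exprn// (_ : 2 * 2 ^+ k.+1 = 4 * t)%R; last first.
    by rewrite exprS -/t; ring.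
  rewrite exprMn -/t opprD powRD; last by apply/implyP => _; rewrite gt_eqF.
  rewrite (powRN t n.+1%:R) powR_mulrn ?(ltW t0)//.
  set u := (t ^+ _)%R; have u0 : (u != 0)%R by rewrite gt_eqF// exprn_gt0.
  by rewrite le_eqVlt; apply/orP; left; apply/eqP; field.
apply: le_lt_trans (measure_sigma_subadditive _ _ mW Wcover) _.
  by move=> k; exact: measurableU.
apply: (@le_lt_trans _ _ (\sum_(k <oo) ((a1 * q1 ^+ k)%:E + (a2 * q2 ^+ k)%:E))).
  apply: lee_nneseries => // k _.
  apply: le_trans (measureU2 _ _ _) _ => //.
  by apply: leeD; [exact: near_le|exact: far_le].
have q1P : (0 < q1 < 1)%R.
  have : (2^-1 `^ (1 - s) < 1 `^ (1 - s) :> R)%R.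
    by apply: gt0_ltr_powR; rewrite ?nnegrE; lra.
  by rewrite powR1 => ->; rewrite andbT; exact: powR_gt0.
have q2P : (0 < q2 < 1)%R.
  have : (1 `^ s < 2 `^ s :> R)%R by apply: gt0_ltr_powR; rewrite ?nnegrE; lra.
  rewrite powR1 /q2 powRN invr_gt0 => s2.
  by rewrite invf_lt1 ?s2 ?andbT powR_gt0.
have a10 : (0 <= a1)%R by rewrite !mulr_ge0// ?powR_ge0 ?exprn_ge0.
have a20 : (0 <= a2)%R by rewrite !mulr_ge0// ?powR_ge0 ?exprn_ge0.
rewrite nneseriesD; last 2 first.
- by move=> k _ _; rewrite lee_fin mulr_ge0// exprn_ge0//; lra.
- by move=> k _ _; rewrite lee_fin mulr_ge0// exprn_ge0//; lra.
by rewrite lte_add_pinfty//; exact: nneseries_geometric_lty.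
Qed.

(** Induction on the list: a pair leaving a union leaves whichever member contains its first
    point. *)
Lemma nu_bigcup_ball_complement_lty s (I : choiceType) (f : I -> T) (r : I -> R)
    (X : seq I) : (0 < s < 1)%R -> (forall i, i \in X -> (0 < r i)%R) ->
  nu s ((\big[setU/set0]_(i <- X) ball (f i) (r i)) `*`
        ~` (\big[setU/set0]_(i <- X) ball (f i) (r i))) < +oo.
Proof.
move=> s01; elim: X => [|i X ih] r0.
  by rewrite big_nil set0X measure0 ltry.
rewrite big_cons; set A := ball _ _; set B := \big[_/_]_(_ <- _) _.
have mA : measurable A by exact: measurable_ball_rV.
have mB : measurable B.
  by apply: bigsetU_measurable => j _; exact: measurable_ball_rV.
have mX (D : set T) : measurable D -> measurable (D `*` ~` D).
  by move=> mD; apply: measurableX => //; exact: measurableC.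
apply: (@le_lt_trans _ _ (nu s (A `*` ~` A) + nu s (B `*` ~` B))).
  apply: le_trans (measureU2 _ (mX _ mA) (mX _ mB)).
  apply: le_measure; rewrite ?inE; first by apply: mX; exact: measurableU.
    by apply: measurableU; exact: mX.
  by move=> [x y] [/= [Ax|Bx] /not_orP[Ay By]]; [left|right].
rewrite lte_add_pinfty//.
  by apply: nu_ball_complement_lty => //; rewrite r0// mem_head.
by apply: ih => j jX; rewrite r0// in_cons jX orbT.
Qed.

End ball_perimeter_finite.

(** * Limits of minimal sets *)

Section stability.
Context (R : realType) (n : nat).
Notation T := 'rV[R]_n.+1.
Notation mu := (@lebesgue_rV R n).
Implicit Types (A B E F O : set T) (s : R).

(** The two crossing sets differ only at pairs with a point in the null set [D]; these are null for
    the product measure, hence for [nu]. *)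
Lemma nu_crossing_mod_null s A B (W : set (T * T)) :
  measurable A -> measurable B -> measurable W -> eq_mod_null A B ->
  nu s (crossing A `&` W) = nu s (crossing B `&` W).
Proof.
move=> + + mW; wlog suff leAB : A B / measurable A -> measurable B ->
    eq_mod_null A B -> nu s (crossing A `&` W) <= nu s (crossing B `&` W).
  move=> mA mB AB; apply/eqP; rewrite eq_le !leAB//.
  by rewrite /eq_mod_null setYC.
move=> mA mB AB.
set D := A `+` B; have mD : measurable D by exact: measurable_symdiff.
pose N := (D `*` setT) `|` (setT `*` D) : set (T * T).
have mN : measurable N by apply: measurableU; exact: measurableX.
have D0 : mu D = 0 by [].
have N0 : nu s N = 0.
  apply: nu_null => //; apply/eqP; rewrite eq_le measure_ge0 andbT.
  apply: le_trans (measureU2 _ _ _) _; [exact: measurableX|exact: measurableX|].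
  rewrite -[leRHS]adde0; apply: leeD.
    (* The product is [0 * mu setT], which is 0 by the convention for [0 * +oo]. *)
    by rewrite [leLHS](product_measure1E mu mu mD measurableT)
      [X in X * _](_ : _ = 0)%E ?mul0e.
  by rewrite [leLHS](product_measure1E mu mu measurableT mD)
    [X in _ * X](_ : _ = 0)%E ?mule0.
rewrite -[leRHS]adde0 -N0.
have mc X : measurable X -> measurable (crossing X `&` W).
  by move=> mX; apply: measurableI => //; exact: measurable_crossing.
apply: le_trans (measureU2 _ (mc _ mB) mN).
apply: le_measure; rewrite ?inE; first exact: mc.
  by apply: measurableU => //; exact: mc.
move=> z [Az Wz]; have [Bz|Bz] := pselect (crossing B z); [by left|right].
by apply: crossing_symdiff_subset; left.
Qed.

Definition local_cvg (E_ : nat -> set T) E :=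
  forall j, mu (cube j `&` (E_ h `+` E)) @[h --> \oo] --> (0 : \bar R).

Lemma set_cvg_loc_local_cvg (E_ : nat -> set T) E :
  (forall h, measurable (E_ h)) -> measurable E ->
  set_cvg_loc E_ E -> local_cvg E_ E.
Proof.
move=> mE_ mE EE j.
have := EE _ (@compact_cube R n j).
apply: cvg_trans; apply: near_eq_cvg; apply: nearW => h.
rewrite setIC -integral_indic; last 2 first.
- exact: measurable_cube.
- exact: measurable_symdiff.
apply: eq_integral => x _; congr EFin; rewrite !indicE !in_setU !in_setD.
by case: (x \in E_ h); case: (x \in E);
  rewrite ?subrr ?subr0 ?sub0r ?normrN ?normr0 ?normr1.
Qed.

(** On [core s j] the kernel is at most [j], and a pair in the symmetric difference has a point in
    [D], the part of the symmetric difference of [E_ h] and [E] inside the cube. With [M] the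
    measure of the cube, the mass is at most [j * (M + M) * mu D]. *)
Lemma local_cvg_core s (E_ : nat -> set T) E :
  (forall h, measurable (E_ h)) -> measurable E -> local_cvg E_ E ->
  forall j (e : R), (0 < e)%R -> \forall h \near \oo,
    nu s (core s j `&` (crossing (E_ h) `+` crossing E)) < e%:E.
Proof.
move=> mE_ mE EE j e e0; have mQ := @measurable_cube R n j.
pose M := fine (mu (cube j)).
have ME : mu (cube j) = M%:E.
  by rewrite fineK// ge0_fin_numE ?measure_ge0// cube_lty.
have M0 : (0 <= M)%R by rewrite fine_ge0// measure_ge0.
pose u h := mu (cube j `&` (E_ h `+` E)).
have ucvg : (j%:R * (M + M))%:E * u h @[h --> \oo] --> (0 : \bar R).
  rewrite -[X in _ --> X](mule0 (j%:R * (M + M))%:E).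
  by apply: cvgeZl => //; exact: EE.
have e0' : (0 : \bar R) < e%:E by rewrite lte_fin.
have := ucvg _ (open_ereal_lt' e0') => near_e.
near=> h.
have : (j%:R * (M + M))%:E * u h < e%:E by near: h.
apply: le_lt_trans.
set S := _ `&` _.
have mD := measurable_symdiff (mE_ h) mE.
have mS : measurable S.
  apply: measurableI; first exact: measurable_core.
  by apply: measurable_symdiff; exact: measurable_crossing.
have SK z : S z -> (kernel s z <= j%:R)%R by move=> [[]].
apply: le_trans (nu_le mS SK) _; rewrite EFinM -muleA lee_wpmul2l ?lee_fin//.
pose D := cube j `&` (E_ h `+` E).
have mDj : measurable D by exact: measurableI.
apply: (@le_trans _ _ ((mu \x mu)%E ((D `*` cube j) `|` (cube j `*` D)))).
  apply: le_measure; rewrite ?inE//.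
    by apply: measurableU; exact: measurableX.
  by move=> z [[[z1 z2] _]] /crossing_symdiff_subset[[z3 _]|[_ z3]]; [left|right].
apply: le_trans (measureU2 _ _ _) _; [exact: measurableX|exact: measurableX|].
rewrite EFinD ge0_muleDl ?lee_fin//; apply: leeD.
  by rewrite [leLHS](product_measure1E mu mu mDj mQ)
    [X in _ * X](ME : _ = M%:E) muleC.
by rewrite [leLHS](product_measure1E mu mu mQ mDj)
  [X in X * _](ME : _ = M%:E).
Unshelve. all: by end_near. Qed.

End stability.

(** * Neighbourhoods of finite perimeter and glued competitors *)

Section stability_of_minimality.
Context (R : realType) (n : nat).
Notation T := 'rV[R]_n.+1.
Notation mu := (@lebesgue_rV R n).
Implicit Types (A B E F O : set T) (s : R).

(** [O] is a finite union of balls covering [K]; the closed balls of the same radii form a compact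
    set [C] in [Omega] that contains the closure of [O]. *)
Lemma exists_finite_perimeter_nbhd s (K Omega : set T) : (0 < s < 1)%R ->
  compact K -> open Omega -> K `<=` Omega ->
  exists O, [/\ open O, compactly_contained O Omega, K `<=` O &
    nu s (O `*` ~` O) < +oo].
Proof.
move=> s01 cK oOmega KOmega.
have /choice[r rP] x : exists rx : R, (0 < rx)%R /\
    (Omega x ->
      [set y : T | forall i, (`|x ord0 i - y ord0 i| <= rx)%R] `<=` Omega).
  have [Ox|nOx] := pselect (Omega x); last by exists 1%R.
  have /nbhs_ballP[e /= e0 eO] : nbhs x Omega by exact: open_nbhs_nbhs.
  (* Halving the radius keeps the closed ball, and not only the open one, inside [Omega]. *)
  exists (e / 2)%R; split=> [|_ y xy]; first by rewrite divr_gt0.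
  apply: eO; apply/ball_rVE => // i; apply: le_lt_trans (xy i) _; lra.
have [D DK KD] : finite_subset_cover K (fun x => ball x (r x)) K.
  move: cK; rewrite compact_cover; apply=> [x _|x Kx]; first exact: ball_open.
  by exists x => //; apply: ballxx; have [] := rP x.
rewrite /cover bigcup_fset in KD.
set X := finmap.enum_fset D in KD.
have XOmega x : x \in X -> Omega x by move=> /DK; rewrite inE => /KOmega.
pose C := \big[setU/set0]_(x <- X)
  [set y : T | forall i, (`|x ord0 i - y ord0 i| <= r x)%R].
have cC : compact C.
  rewrite /C; elim: (X) => [|x Y ih]; first by rewrite big_nil; exact: compact0.
  by rewrite big_cons; apply: compactU => //; exact: compact_closed_ball_rV.
have COmega : C `<=` Omega.
  by rewrite /C -bigcup_seq => y [x /= xX]; apply: (rP x).2; exact: XOmega.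
exists (\big[setU/set0]_(x <- X) ball x (r x)).
have oO : open (\big[setU/set0]_(x <- X) ball x (r x)).
  by rewrite -bigcup_seq; apply: bigcup_open => x _; exact: ball_open.
have OC : closure (\big[setU/set0]_(x <- X) ball x (r x)) `<=` C.
  rewrite (iffLR (closure_id C)); last first.
    exact: compact_closed (@norm_hausdorff _ _) cC.
  apply: closure_subset; rewrite /C -!bigcup_seq => y [x xX xy].
  by exists x => // i; move/(ball_rVE _ _ (rP x).1) : xy => /(_ i)/ltW.
split => //.
- split; last exact: subset_trans COmega.
  by apply: subclosed_compact OC; [exact: closed_closure|].
- by apply: nu_bigcup_ball_complement_lty => // x _; exact: (rP x).1.
Qed.

(** [F] inside [O] glued to [E_ h] outside is a competitor for [E_ h]. Its perimeter has a part
    independent of [h], from pairs inside [O], and a part on the finite-mass set [W], where upper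
    semicontinuity applies. *)
Lemma perimeter_near_le_competitor s (E_ : nat -> set T) E F O :
  (forall h, measurable (E_ h)) -> measurable E -> measurable F ->
  measurable O ->
  nu s (O `*` ~` O) < +oo -> local_cvg E_ E ->
  (forall h, minimal s (E_ h) O) -> eq_mod_null (F `\` O) (E `\` O) ->
  forall e : R, (0 < e)%R -> \forall h \near \oo,
    perimeter s (E_ h) O <= perimeter s F O + e%:E.
Proof.
move=> mE_ mE mF mO O_fin EE minE FE e e0.
pose glue A := (F `&` O) `|` (A `\` O).
have mglue A : measurable A -> measurable (glue A).
  by move=> mA; apply: measurableU; [exact: measurableI|exact: measurableD].
pose W := (O `*` ~` O) `|` (~` O `*` O) : set (T * T).
have mOO : measurable (O `*` O : set (T * T)) by exact: measurableX.
have mOc := measurableC mO.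
have mW : measurable W by apply: measurableU; exact: measurableX.
have W_fin : nu s W < +oo.
  apply: le_lt_trans (measureU2 _ _ _) _; [exact: measurableX|exact: measurableX|].
  by rewrite lte_add_pinfty// [ltLHS](nu_swap s mOc mO).
have mglueE := mglue _ mE.
have mcross A : measurable A -> measurable (crossing (glue A)).
  by move=> mA; apply: measurable_crossing; exact: mglue.
have touchE : touching O = (O `*` O) `|` W.
  apply/seteqP; split => -[x y]; rewrite /touching /W /=.
    by have := pselect (O x); have := pselect (O y); tauto.
  tauto.
have perE A : measurable A -> nu s (crossing (glue A) `&` touching O) =
    nu s (crossing F `&` (O `*` O)) + nu s (crossing (glue A) `&` W).
  move=> mA; rewrite touchE setIUr measureU.
  - congr (nu s _ + _).
    by apply/seteqP; split => -[x y]; rewrite /glue /crossing /=; tauto.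
  - by apply: measurableI => //; exact: mcross.
  - by apply: measurableI => //; exact: mcross.
  - rewrite -subset0 => -[x y]; rewrite /W /=; tauto.
have glue_cvg : local_cvg (fun h => glue (E_ h)) (glue E).
  move=> j; apply: (@squeeze_cvge _ _ _ _ (cst 0) _
    (fun h => mu (cube j `&` (E_ h `+` E)))).
  - apply: nearW => h; rewrite measure_ge0/=.
    apply: le_measure; rewrite ?inE.
    + by apply: measurableI; [exact: measurable_cube|];
        apply: measurable_symdiff; exact: mglue.
    + by apply: measurableI; [exact: measurable_cube|exact: measurable_symdiff].
    + by move=> x; rewrite /glue /=; tauto.
  - exact: cvg_cst.
  - exact: EE.
have core_cvg := local_cvg_core s (fun h => mglue _ (mE_ h)) mglueE glue_cvg.
have near_W := near_le_limsup (@measurable_core R n s)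
  (@core_nondecreasing R n s)
  (@bigcup_core R n s) (fun h => mcross _ (mE_ h)) (mcross _ mE) core_cvg mW
  W_fin e0.
have glueEF : perimeter s F O = perimeter s (glue E) O.
  (* [F] and [glue E] agree in [O], and outside [O] they differ by a null set. *)
  rewrite !perimeterE//; apply: nu_crossing_mod_null => //.
    exact: measurable_touching.
  apply/eqP; rewrite eq_le measure_ge0 andbT -[leRHS](FE : _ = 0).
  apply: le_measure; rewrite ?inE.
  - exact: measurable_symdiff.
  - by apply: measurable_symdiff; exact: measurableD.
  - by move=> x; rewrite /glue /=; have := pselect (O x); tauto.
rewrite glueEF (perimeterE _ mglueE mO) (perE _ mE).
near=> h.
apply: (@le_trans _ _ (perimeter s (glue (E_ h)) O)).
  apply: (minE h).2; first exact: mglue.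
  have -> : glue (E_ h) `\` O = E_ h `\` O.
    by apply/seteqP; split => x; rewrite /glue /=; tauto.
  by rewrite /eq_mod_null setYK; exact: measure0.
rewrite (perimeterE _ (mglue _ (mE_ h)) mO).
rewrite (perE _ (mE_ h)) -[leRHS]addeA; apply: leeD; first exact: lexx.
by near: h.
Unshelve. all: by end_near. Qed.

End stability_of_minimality.

(** * Minimality of the limit and convergence of perimeters *)

Lemma cvge_fin_between (R : realType) (u : nat -> \bar R) (a : R) :
  (forall e : R, (0 < e)%R ->
    \forall h \near \oo, (a - e)%:E < u h /\ u h < (a + e)%:E) ->
  u h @[h --> \oo] --> a%:E.
Proof.
move=> ua; have fin_u : \forall h \near \oo, u h \is a fin_num.
  apply: filterS (ua 1%R ltr01) => h [h1 h2].
  rewrite fin_numE gt_eqF ?lt_eqF// ?(lt_trans _ h1) ?ltNyr//.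
  by rewrite (lt_trans h2)// ltry.
apply/fine_cvgP; split=> //; apply/cvgrPdist_lt => e e0.
near=> h; have [h1 h2] : (a - e)%:E < u h /\ u h < (a + e)%:E.
  by near: h; exact: ua.
have hf : u h \is a fin_num by near: h.
move: h1 h2; rewrite -(fineK hf) !lte_fin /= ltr_distlC => -> ->.
by [].
Unshelve. all: by end_near. Qed.

Section limit_of_minimal_sets.
Context (R : realType) (n : nat).
Notation T := 'rV[R]_n.+1.
Variables (s : R) (E_ : nat -> set T) (E O : set T).
Hypotheses (mE_ : forall h, measurable (E_ h)) (mE : measurable E).
Hypothesis E_cvg : local_cvg E_ E.
Hypotheses (mO : measurable O) (O_fin : nu s (O `*` ~` O) < +oo).
Hypothesis E_min : forall h, minimal s (E_ h) O.

Let lsc (W : set (T * T)) (r : R) : measurable W ->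
  r%:E < nu s (crossing E `&` W) ->
  \forall h \near \oo, r%:E < nu s (crossing (E_ h) `&` W).
Proof.
move=> mW; have mcE := measurable_crossing mE.
have mcE_ h := measurable_crossing (mE_ h).
exact: (lt_near_liminf (@measurable_core R n s) (@core_nondecreasing R n s)
  (@bigcup_core R n s) mcE_ mcE (local_cvg_core s mE_ mE E_cvg) mW).
Qed.

(** A competitor [F] beating [E] by more than [e] would, for large [h], force the perimeter of
    [E_ h] above that of [F] plus [e] by lower semicontinuity, yet below that of [F] plus [e / 2] by
    gluing. *)
Lemma minimal_limit : minimal s E O.
Proof.
have leEF F : measurable F -> eq_mod_null (F `\` O) (E `\` O) ->
    perimeter s E O <= perimeter s F O.
  move=> mF FE; rewrite leNgt; apply/negP.
  have P0 : 0 <= perimeter s F O by rewrite perimeterE.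
  move: P0 (perimeter_near_le_competitor mE_ mE mF mO O_fin E_cvg E_min FE).
  case: (perimeter s F O) => [f| |] // _ usc; last by rewrite ltNge leey.
  move=> /lt_ereal_gap[e e0]; rewrite perimeterE//.
  move=> /lsc -/(_ (measurable_touching mO)) lscE.
  have e20 : (0 < e / 2)%R by rewrite divr_gt0.
  have [h [h1 h2]] := filter_ex (filterI (usc _ e20) lscE).
  move: h1 h2; rewrite /= -perimeterE// => h1 /lt_le_trans/(_ h1).
  by rewrite -EFinD lte_fin; lra.
split => //; have mEO := measurableD mE mO.
(* Finiteness: for the competitor with [O] removed, every crossing pair touching [O] goes from
   outside [O] into [O]. *)
apply: (@le_lt_trans _ _ (perimeter s (E `\` O) O)).
  by apply: leEF => //; rewrite /eq_mod_null setDDl setUid setYK measure0.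
rewrite perimeterE//; apply: le_lt_trans O_fin.
rewrite nu_swap//; last exact: measurableC.
apply: le_measure; rewrite ?inE.
- apply: measurableI; first exact: measurable_crossing.
  exact: measurable_touching.
- by apply: measurableX => //; exact: measurableC.
- by move=> [x y]; rewrite /crossing /touching /=; tauto.
Qed.

Variables (O' : set T).
Hypotheses (mO' : measurable O') (O'O : O' `<=` O).

Let rest := touching O `\` touching O'.

Let mrest : measurable rest.
Proof. by apply: measurableD; exact: measurable_touching. Qed.

Let perimeter_split A : measurable A ->
  perimeter s A O = perimeter s A O' + nu s (crossing A `&` rest).
Proof.
move=> mA; have mcA := measurable_crossing mA.
rewrite !perimeterE// -measureU.
- rewrite -setIUr setDUK// => -[x y]; rewrite /touching /=.
  by have := O'O (t := x); have := O'O (t := y); tauto.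
- by apply: measurableI => //; exact: measurable_touching.
- exact: measurableI.
- by rewrite -subset0 => z [[_ ?] [_ [_]]].
Qed.

Let rest_fin : nu s (crossing E `&` rest) \is a fin_num.
Proof.
rewrite ge0_fin_numE ?measure_ge0//; apply: le_lt_trans minimal_limit.1.
by rewrite perimeter_split// leeDr// perimeterE.
Qed.

Let perimeter_fin : perimeter s E O' \is a fin_num.
Proof.
have P0 : 0 <= perimeter s E O' by rewrite perimeterE.
rewrite ge0_fin_numE//; apply: le_lt_trans minimal_limit.1.
by rewrite perimeter_split// leeDl// measure_ge0.
Qed.

(** A competitor in [O'] is also one in [O]. Pairs in [rest] have both points outside [O'], so their
    contribution is the same for [F] and [E]; being finite, it cancels. *)
Lemma minimal_limit_subset : minimal s E O'.
Proof.
split; first by rewrite ltey_eq perimeter_fin.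
move=> F mF FE.
have FEO : eq_mod_null (F `\` O) (E `\` O).
  apply/eqP; rewrite eq_le measure_ge0 andbT -[leRHS](FE : _ = 0).
  apply: le_measure; rewrite ?inE.
  - by apply: measurable_symdiff; exact: measurableD.
  - by apply: measurable_symdiff; exact: measurableD.
  - by move=> x; have := O'O (t := x); rewrite /=; tauto.
have restE A : crossing A `&` rest = crossing (A `\` O') `&` rest.
  by apply/seteqP; split => -[x y]; rewrite /rest /crossing /touching /=; tauto.
have restEF : nu s (crossing F `&` rest) = nu s (crossing E `&` rest).
  rewrite restE [in RHS]restE.
  by apply: nu_crossing_mod_null => //; exact: measurableD.
have := minimal_limit.2 F mF FEO.
by rewrite (perimeter_split mF) (perimeter_split mE) restEF leeD2rE.
Qed.

(** The lower bound is semicontinuity on pairs touching [O']. For the upper bound, [E] as its own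
    competitor controls the perimeter in [O] by [a + b + e / 2], while semicontinuity on [rest]
    leaves more than [b - e / 2] there; the difference is [a + e]. *)
Lemma perimeter_cvg : perimeter s (E_ h) O' @[h --> \oo] --> perimeter s E O'.
Proof.
have EO : eq_mod_null (E `\` O) (E `\` O).
  by rewrite /eq_mod_null setYK measure0.
have := perimeter_near_le_competitor mE_ mE mE mO O_fin E_cvg E_min EO.
rewrite perimeter_split// -(fineK perimeter_fin) -(fineK rest_fin) => uscE.
set a := fine (perimeter s E O') in uscE *; set b := fine _ in uscE.
have aE : perimeter s E O' = a%:E by rewrite fineK.
have bE : nu s (crossing E `&` rest) = b%:E by rewrite fineK.
apply: cvge_fin_between => e e0.
have e20 : (0 < e / 2)%R by rewrite divr_gt0.
near=> h; split.
  rewrite perimeterE//; near: h; apply: lsc; first exact: measurable_touching.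
  by rewrite -perimeterE// aE lte_fin; lra.
have h1 : (b - e / 2)%:E < nu s (crossing (E_ h) `&` rest).
  by near: h; apply: lsc => //; rewrite bE lte_fin; lra.
have h2 : perimeter s (E_ h) O <= (a + b + e / 2)%:E.
  by near: h; rewrite -!EFinD in uscE; exact: uscE.
rewrite ltNge; apply/negP => h3; move: h2; rewrite leNgt => /negP; apply.
rewrite perimeter_split//.
rewrite (_ : a + b + e / 2 = (a + e) + (b - e / 2))%R; last by lra.
by rewrite EFinD; apply: lee_ltD.
Unshelve. all: by end_near. Qed.

End limit_of_minimal_sets.

Local Close Scope ereal_scope.

Theorem corollary1p12 (R : realType) (n : nat) (s : R) (s_gt0 : 0 < s)
    (s_lt1 : s < 1) (Omega : set 'rV[R]_n.+1) (Omega_open : open Omega)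
    (E_ : nat -> set 'rV[R]_n.+1) (E : set 'rV[R]_n.+1)
    (E_meas : forall h, measurable (E_ h)) (E_lim_meas : measurable E)
    (E_min : forall h, locally_minimal s (E_ h) Omega)
    (E_cvg : set_cvg_loc E_ E) :
  locally_minimal s E Omega /\
  forall Omega' : set 'rV[R]_n.+1,
    open Omega' -> compactly_contained Omega' Omega ->
    perimeter s (E_ h) Omega' @[h --> \oo] --> perimeter s E Omega'.
Proof.
have EE := set_cvg_loc_local_cvg E_meas E_lim_meas E_cvg.
suff claim : forall Omega', open Omega' -> compactly_contained Omega' Omega ->
    minimal s E Omega' /\
    perimeter s (E_ h) Omega' @[h --> \oo] --> perimeter s E Omega'.
  by split=> O' oO' cO'; have [] := claim O' oO' cO'.
move=> Omega' oO' [cO' O'Omega].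
have s01 : 0 < s < 1 by rewrite s_gt0.
(* [Omega'] itself may have infinite perimeter, so both conclusions are drawn from an intermediate
   [V] around its closure. *)
have [V [oV VOmega O'V V_fin]] :=
  exists_finite_perimeter_nbhd s01 cO' Omega_open O'Omega.
have mV := open_measurable_rV oV; have mO' := open_measurable_rV oO'.
have minV h := E_min h V oV VOmega.
have sub := subset_trans (@subset_closure _ Omega') O'V.
split.
  exact: minimal_limit_subset E_meas E_lim_meas EE mV V_fin minV _ mO' sub.
exact: perimeter_cvg E_meas E_lim_meas EE mV V_fin minV _ mO' sub.
Qed.
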